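(* The set of pairs $(R,t)$ with $R$ a finite TRS and $t$ a term such that $R$ is confluent on $t$ is $\Pi^0_2$-complete; and the set of pairs $(R,t)$ with $t$ a ground term such that $R$ is confluent on $t$ is $\Pi^0_2$-complete.
   Context: All TRSs are finite sets of rules over a finite signature; terms may contain variables, ground terms contain none. A TRS $R$ is confluent on a term $t$ if for all terms $t_1,t_2$ with $t_1 \leftarrow_R^* t\to_R^* t_2$ there is a term $d$ with $t_1\to_R^* d\leftarrow_R^* t_2$. TRSs and terms are encoded as natural numbers by a standard effective Gödel numbering, and properties are identified with the corresponding sets of codes. $\Sigma^0_n,\Pi^0_n$ are the classes of the arithmetical hierarchy; a set $B$ is $\mathcal P$-complete if $B\in\mathcal P$ and every $A\in\mathcal P$ is many-one reducible to $B$ via a total computable function. *)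

(* Defs.v *)
From Stdlib Require Import Arith List Relations.
Import ListNotations.

(* Function symbols are named by naturals; a symbol occurrence [Fn f args]
   is identified with the pair (f, length args), so arities are fixed
   per symbol.  Variables are named by naturals. *)
Inductive term : Type :=
| Var : nat -> term
| Fn  : nat -> list term -> term.

Definition rule : Type := (term * term)%type.
Definition trs : Type := list rule.

Fixpoint subst (sigma : nat -> term) (t : term) : term :=
  match t with
  | Var x => sigma x
  | Fn f args => Fn f (map (subst sigma) args)
  end.

Fixpoint vars (t : term) : list nat :=
  match t with
  | Var x => [x]
  | Fn _ args => (fix vl (l : list term) : list nat :=
                    match l with nil => nil | a :: l' => vars a ++ vl l' end) args
  end.

Definition ground (t : term) : Prop := vars t = nil.

Definition wf_rule (lr : rule) : Prop :=
  (forall x, fst lr <> Var x) /\ (forall x, In x (vars (snd lr)) -> In x (vars (fst lr))).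
Definition wf_trs (R : trs) : Prop := forall lr, In lr R -> wf_rule lr.

Inductive step (R : trs) : term -> term -> Prop :=
| step_root : forall l r sigma, In (l, r) R -> step R (subst sigma l) (subst sigma r)
| step_ctx  : forall f a b s t, step R s t -> step R (Fn f (a ++ s :: b)) (Fn f (a ++ t :: b)).

Definition steps (R : trs) : term -> term -> Prop := clos_refl_trans term (step R).

Definition confluent_on (R : trs) (t : term) : Prop :=
  forall t1 t2, steps R t t1 -> steps R t t2 -> exists d, steps R t1 d /\ steps R t2 d.

Definition cpair (x y : nat) : nat := (x + y) * (x + y + 1) / 2 + y.

Fixpoint enc_term (t : term) : nat :=
  match t with
  | Var x => 2 * x
  | Fn f args => 2 * cpair f ((fix el (l : list term) : nat :=
                                 match l with
                                 | nil => 0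
                                 | a :: l' => S (cpair (enc_term a) (el l'))
                                 end) args) + 1
  end.

Fixpoint enc_trs (R : trs) : nat :=
  match R with
  | nil => 0
  | (l, r) :: R' => S (cpair (cpair (enc_term l) (enc_term r)) (enc_trs R'))
  end.

Definition enc_pair (R : trs) (t : term) : nat := cpair (enc_trs R) (enc_term t).

Inductive code : Type :=
| CZero : code
| CSucc : code
| CProj : nat -> code
| CComp : code -> list code -> code
| CPrec : code -> code -> code
| CMu   : code -> code.

Inductive eval : code -> list nat -> nat -> Prop :=
| ev_zero : forall v, eval CZero v 0
| ev_succ : forall v, eval CSucc v (S (hd 0 v))
| ev_proj : forall i v, eval (CProj i) v (nth i v 0)
| ev_comp : forall f gs v ys z, evals gs v ys -> eval f ys z -> eval (CComp f gs) v z
| ev_prec0 : forall f g v z, eval f v z -> eval (CPrec f g) (0 :: v) z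
| ev_precS : forall f g n v y z, eval (CPrec f g) (n :: v) y -> eval g (n :: y :: v) z ->
             eval (CPrec f g) (S n :: v) z
| ev_mu : forall f v n, eval f (n :: v) 0 ->
          (forall m, m < n -> exists k, eval f (m :: v) (S k)) -> eval (CMu f) v n
with evals : list code -> list nat -> list nat -> Prop :=
| evs_nil : forall v, evals nil v nil
| evs_cons : forall g gs v y ys, eval g v y -> evals gs v ys -> evals (g :: gs) v (y :: ys).

Definition computable (f : nat -> nat) : Prop :=
  exists c, forall n, eval c [n] (f n).

Definition decidable3 (P : nat -> nat -> nat -> Prop) : Prop :=
  exists c, forall a b d, exists v, eval c [a; b; d] v /\ (P a b d <-> v = 0).

Definition Pi02 (A : nat -> Prop) : Prop :=
  exists P, decidable3 P /\ forall n, A n <-> forall x, exists y, P n x y.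

Definition many_one_reducible (B A : nat -> Prop) : Prop :=
  exists f, computable f /\ forall n, B n <-> A (f n).

Definition Pi02_complete (A : nat -> Prop) : Prop :=
  Pi02 A /\ forall B, Pi02 B -> many_one_reducible B A.

Definition CONF_term : nat -> Prop := fun n =>
  exists R t, n = enc_pair R t /\ wf_trs R /\ confluent_on R t.

Definition CONF_ground_term : nat -> Prop := fun n =>
  exists R t, n = enc_pair R t /\ wf_trs R /\ ground t /\ confluent_on R t.

(* Main.v *)
(** Membership.  One-step rewriting, reachability, "every variable of s occurs in t" and
    well-formedness of a TRS are least models of Horn clauses over codes; a derivation is
    checked by iterating a primitive recursive step on an agenda of goals, guided by an
    oracle number that supplies the clauses and their instances.  Confluence on t reads:
    for all reducts of t with their derivations there is a common reduct with its
    derivations.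

    Hardness.  One fixed TRS interprets the codes of partial recursive functions by an
    abstract machine with a stack of continuations; its redexes lie only at the root, and
    it is deterministic.  Let c compute a characteristic function of P.  The term
    guess(c,n,x) rewrites to guess(c,n,x+1), to the normal form accept, and to the machine
    state that searches a y with P(n,x,y) and rewrites to accept when it has found one.
    If every search succeeds, every reduct of guess(c,n,0) reduces to accept; and if the
    search for some x fails, its states and accept have no common reduct. *)

From Stdlib Require Import Arith List Relations Lia.
Require Import Defs.
Import ListNotations.

(** * Pairing *)

(** Triangular numbers remove the division from [cpair], leaving a form suited to [lia] and to
    primitive recursion. *)
Fixpoint tri (n : nat) : nat := match n with 0 => 0 | S m => tri m + S m end.

Lemma tri_div n : n * (n + 1) / 2 = tri n.
Proof.
  enough (H : n * (n + 1) = tri n * 2) by (rewrite H; apply Nat.div_mul; lia).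
  induction n; cbn [tri]; lia.
Qed.

Lemma cpair_tri x y : cpair x y = tri (x + y) + y.
Proof. unfold cpair; now rewrite tri_div. Qed.

Lemma tri_mono a b : a <= b -> tri a <= tri b.
Proof. induction 1; cbn [tri]; lia. Qed.

(** A conditional on [a = 0], built from truncated subtraction so that closure under arithmetic
    makes it computable. *)
Definition ifz (a b c : nat) : nat := (1 - a) * b + (1 - (1 - a)) * c.

Lemma ifz_0 b c : ifz 0 b c = b.
Proof. change (ifz 0 b c) with (1 * b + 0 * c). lia. Qed.

Lemma ifz_S a b c : ifz (S a) b c = c.
Proof. change (ifz (S a) b c) with (0 * b + 1 * c). lia. Qed.

(** The antidiagonal holding [z], that is, the largest [d] with [tri d <= z]. Passing from [n] to
    [S n] moves to the next antidiagonal exactly when [tri (S y) <= S n]. *)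
Definition diag (z : nat) : nat :=
  nat_rect (fun _ => nat) 0 (fun n y => ifz (tri (S y) - S n) (S y) y) z.

Definition pi2 (z : nat) : nat := z - tri (diag z).
Definition pi1 (z : nat) : nat := diag z - pi2 z.

Lemma diag_spec z : tri (diag z) <= z < tri (S (diag z)).
Proof.
  induction z as [|z IH]; [cbn; lia|].
  change (diag (S z)) with (ifz (tri (S (diag z)) - S z) (S (diag z)) (diag z)).
  destruct (tri (S (diag z)) - S z) eqn:E.
  - rewrite ifz_0. cbn [tri] in *. lia.
  - rewrite ifz_S. cbn [tri] in *. lia.
Qed.

Lemma diag_cpair x y : diag (cpair x y) = x + y.
Proof.
  pose proof (diag_spec (cpair x y)) as [H1 H2]. pose proof (cpair_tri x y) as E.
  destruct (Nat.lt_trichotomy (diag (cpair x y)) (x + y)) as [H|[H|H]]; auto.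
  - pose proof (tri_mono (S (diag (cpair x y))) (x + y) H). lia.
  - pose proof (tri_mono _ _ H). cbn [tri] in *. lia.
Qed.

Lemma pi2_cpair x y : pi2 (cpair x y) = y.
Proof. unfold pi2; rewrite diag_cpair, cpair_tri; lia. Qed.

Lemma pi1_cpair x y : pi1 (cpair x y) = x.
Proof. unfold pi1; rewrite pi2_cpair, diag_cpair; lia. Qed.

Lemma cpair_pi z : cpair (pi1 z) (pi2 z) = z.
Proof.
  pose proof (diag_spec z) as [H1 H2]. rewrite cpair_tri. unfold pi1, pi2. cbn [tri] in H2.
  replace (diag z - (z - tri (diag z)) + (z - tri (diag z))) with (diag z) by lia. lia.
Qed.

Lemma cpair_inj a b c d : cpair a b = cpair c d -> a = c /\ b = d.
Proof.
  intros H; split; [rewrite <- (pi1_cpair a b), H|rewrite <- (pi2_cpair a b), H];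
    auto using pi1_cpair, pi2_cpair.
Qed.

Lemma cpair_le a b : a <= cpair a b /\ b <= cpair a b.
Proof.
  rewrite cpair_tri. split; [|lia].
  enough (a + b <= tri (a + b)) by lia. induction (a + b); cbn [tri]; lia.
Qed.

Arguments cpair : simpl never.
Arguments pi1 : simpl never.
Arguments pi2 : simpl never.
Arguments Nat.mul : simpl never.

(** * Computable functions on environments *)

(** The list [v] may have any length: missing entries read as 0, so the closure lemmas need no
    arities. *)
Definition cf (F : list nat -> nat) : Prop := exists c, forall v, eval c v (F v).

Lemma cf_ext F G : (forall v, F v = G v) -> cf F -> cf G.
Proof. intros E [c H]; exists c; intros v; rewrite <- E; apply H. Qed.

Lemma cf_proj i : cf (fun v => nth i v 0).
Proof. exists (CProj i); intros; constructor. Qed.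

Lemma cf_comp F Gs : cf F -> Forall cf Gs -> cf (fun v => F (map (fun G => G v) Gs)).
Proof.
  intros [c Hc] HG.
  assert (exists cs, forall v, evals cs v (map (fun G => G v) Gs)) as [cs Hcs].
  { induction HG as [|G Gs [g Hg] _ [gs Hgs]]; [exists []; constructor|].
    exists (g :: gs); intros; constructor; auto. }
  exists (CComp c cs); intros; econstructor; eauto.
Qed.

Lemma cf_S G : cf G -> cf (fun v => S (G v)).
Proof.
  intros H. apply (cf_comp (fun v => S (hd 0 v)) [G]); auto.
  exists CSucc; constructor.
Qed.

Lemma cf_const n : cf (fun _ => n).
Proof.
  induction n; [exists CZero; constructor|].
  exact (cf_S (fun _ => n) IHn).
Qed.

(** One parameter suffices, since several values can be paired into [A]. Composing with [[n; a]]
    fixes the shape of the list on which [CPrec] runs. *)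
Lemma cf_rec (b : nat -> nat) (s : nat -> nat -> nat -> nat) :
  cf (fun v => b (nth 0 v 0)) ->
  cf (fun v => s (nth 0 v 0) (nth 1 v 0) (nth 2 v 0)) ->
  forall N A, cf N -> cf A ->
  cf (fun v => nat_rect (fun _ => nat) (b (A v)) (fun n y => s n y (A v)) (N v)).
Proof.
  intros [cb Hb] [cs Hs] N A [n Hn] [a Ha].
  exists (CComp (CPrec cb cs) [n; a]). intros v.
  apply ev_comp with (ys := [N v; A v]); [repeat constructor; auto|].
  induction (N v) as [|m IH]; cbn [nat_rect].
  - apply ev_prec0. apply (Hb [A v]).
  - eapply ev_precS; [exact IH|]. apply (Hs [m; _; A v]).
Qed.

Lemma cf_add F G : cf F -> cf G -> cf (fun v => F v + G v).
Proof.
  intros HF HG.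
  refine (cf_ext _ _ _ (cf_rec (fun a => a) (fun _ y _ => S y) _ _ F G HF HG)).
  - intros v; cbn. induction (F v); cbn; auto.
  - apply cf_proj.
  - apply cf_S, cf_proj.
Qed.

Lemma cf_mul F G : cf F -> cf G -> cf (fun v => F v * G v).
Proof.
  intros HF HG.
  refine (cf_ext _ _ _ (cf_rec (fun _ => 0) (fun _ y a => a + y) _ _ F G HF HG)).
  - intros v; cbn. induction (F v) as [|n IH]; cbn; [lia|]. rewrite IH; lia.
  - apply cf_const.
  - apply cf_add; apply cf_proj.
Qed.

Lemma cf_pred F : cf F -> cf (fun v => pred (F v)).
Proof.
  intros HF.
  refine (cf_ext _ _ _ (cf_rec (fun _ => 0) (fun n _ _ => n) _ _ F (fun _ => 0) HF (cf_const 0))).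
  - intros v; cbn. destruct (F v); reflexivity.
  - apply cf_const.
  - apply cf_proj.
Qed.

Lemma cf_sub F G : cf F -> cf G -> cf (fun v => F v - G v).
Proof.
  intros HF HG.
  refine (cf_ext _ _ _ (cf_rec (fun a => a) (fun _ y _ => pred y) _ _ G F HG HF)).
  - intros v; cbn. induction (G v) as [|n IH]; cbn; [lia|]. rewrite IH; lia.
  - apply cf_proj.
  - apply cf_pred, cf_proj.
Qed.

Lemma cf_tri F : cf F -> cf (fun v => tri (F v)).
Proof.
  intros HF.
  refine (cf_ext _ _ _
    (cf_rec (fun _ => 0) (fun n y _ => y + S n) _ _ F (fun _ => 0) HF (cf_const 0))).
  - intros v; cbn. induction (F v) as [|n IH]; cbn [nat_rect tri]; lia.
  - apply cf_const.
  - apply cf_add; [|apply cf_S]; apply cf_proj.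
Qed.

Lemma cf_ifz F G H : cf F -> cf G -> cf H -> cf (fun v => ifz (F v) (G v) (H v)).
Proof.
  intros HF HG HH. unfold ifz.
  repeat (apply cf_add || apply cf_mul || apply cf_sub); auto; apply cf_const.
Qed.

Lemma cf_diag F : cf F -> cf (fun v => diag (F v)).
Proof.
  intros HF.
  apply (cf_rec (fun _ => 0) (fun n y _ => ifz (tri (S y) - S n) (S y) y)
           (cf_const 0)) with (A := fun _ => 0); auto using cf_const.
  apply cf_ifz; [apply cf_sub; [apply cf_tri|]| |]; try apply cf_S; apply cf_proj.
Qed.

Lemma cf_pi2 F : cf F -> cf (fun v => pi2 (F v)).
Proof. intros HF. apply cf_sub; [|apply cf_tri, cf_diag]; auto. Qed.

Lemma cf_pi1 F : cf F -> cf (fun v => pi1 (F v)).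
Proof. intros HF. apply cf_sub; [apply cf_diag|apply cf_pi2]; auto. Qed.

Lemma cf_cpair F G : cf F -> cf G -> cf (fun v => cpair (F v) (G v)).
Proof.
  intros HF HG. apply (cf_ext (fun v => tri (F v + G v) + G v)).
  - intros; now rewrite cpair_tri.
  - apply cf_add; [apply cf_tri, cf_add|]; auto.
Qed.

Definition neqz (a b : nat) : nat := (a - b) + (b - a).

Lemma cf_neqz F G : cf F -> cf G -> cf (fun v => neqz (F v) (G v)).
Proof. intros HF HG. apply cf_add; apply cf_sub; auto. Qed.

Ltac cf_solve :=
  repeat first [ assumption | apply cf_const | apply cf_proj
               | apply cf_cpair | apply cf_pi1 | apply cf_pi2 | apply cf_ifz
               | apply cf_neqz | apply cf_S | apply cf_pred | apply cf_add | apply cf_mul ].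

(** * Codes of terms *)

(** Nested induction: the hypothesis reaches the arguments stored in the list. *)
Lemma term_rect' (P : term -> Prop) :
  (forall x, P (Var x)) -> (forall f l, Forall P l -> P (Fn f l)) -> forall t, P t.
Proof.
  intros HV HF. fix IH 1. intros [x|f l]; [apply HV|apply HF].
  induction l; constructor; auto.
Qed.

Fixpoint enc_list (l : list term) : nat :=
  match l with [] => 0 | a :: l' => S (cpair (enc_term a) (enc_list l')) end.

Lemma enc_Var x : enc_term (Var x) = 2 * x.
Proof. reflexivity. Qed.

Lemma enc_Fn f l : enc_term (Fn f l) = S (2 * cpair f (enc_list l)).
Proof. now rewrite <- Nat.add_1_r. Qed.

Lemma vars_Fn f l : vars (Fn f l) = flat_map vars l.
Proof. cbn. induction l as [|a l IH]; cbn; congruence. Qed.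

Arguments enc_term : simpl never.
Arguments vars : simpl never.

Lemma enc_list_inj_Forall l :
  Forall (fun a => forall b, enc_term a = enc_term b -> a = b) l ->
  forall m, enc_list l = enc_list m -> l = m.
Proof.
  induction 1 as [|a l Ha _ IH]; intros [|b m] E; cbn in E; try lia; auto.
  apply eq_add_S, cpair_inj in E as [E1 E2]. f_equal; auto.
Qed.

Lemma enc_term_inj s t : enc_term s = enc_term t -> s = t.
Proof.
  revert t. induction s as [x|f l IH] using term_rect'; intros [y|g m] E;
    rewrite ?enc_Var, ?enc_Fn in E; try lia.
  - f_equal; lia.
  - assert (E' : cpair f (enc_list l) = cpair g (enc_list m)) by lia.
    apply cpair_inj in E' as [-> E']. f_equal. now apply enc_list_inj_Forall.
Qed.

Lemma enc_list_inj l m : enc_list l = enc_list m -> l = m.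
Proof. apply enc_list_inj_Forall, Forall_forall. auto using enc_term_inj. Qed.

(** The entries of a list coded by [S m] have codes at most [m], so term codes below [n] suffice for
    list codes up to [n]. This is the list half of the induction in [enc_term_surj]. *)
Lemma enc_list_surj_below n :
  (forall m, m < n -> exists t, enc_term t = m) -> forall m, m <= n -> exists l, enc_list l = m.
Proof.
  intros H m. induction m as [m IH] using lt_wf_ind. intros Hm.
  destruct m as [|m]; [now exists []|].
  pose proof (cpair_pi m) as E. pose proof (cpair_le (pi1 m) (pi2 m)) as [L1 L2].
  destruct (H (pi1 m)) as [a Ha]; [lia|]. destruct (IH (pi2 m)) as [l Hl]; [lia..|].
  exists (a :: l). cbn. congruence.
Qed.

(** Parity separates variables from applications. As every number codes a term, quantifiers over
    terms become quantifiers over numbers without a validity test. *)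
Lemma enc_term_surj n : exists t, enc_term t = n.
Proof.
  induction n as [n IH] using lt_wf_ind.
  destruct (Nat.Even_or_Odd n) as [[x ->]|[x ->]]; [now exists (Var x)|].
  pose proof (cpair_pi x) as E. pose proof (cpair_le (pi1 x) (pi2 x)) as [L1 L2].
  destruct (enc_list_surj_below _ IH (pi2 x)) as [l Hl]; [lia|].
  exists (Fn (pi1 x) l). rewrite enc_Fn, Hl, E. lia.
Qed.

Lemma enc_list_surj n : exists l, enc_list l = n.
Proof. apply (enc_list_surj_below n); auto using enc_term_surj. Qed.

Definition enc_rule (p : rule) : nat := cpair (enc_term (fst p)) (enc_term (snd p)).

Lemma enc_rule_inj p q : enc_rule p = enc_rule q -> p = q.
Proof.
  destruct p, q. intros E; apply cpair_inj in E as [E1 E2].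
  apply enc_term_inj in E1, E2. cbn in *; congruence.
Qed.

Lemma enc_trs_cons p R : enc_trs (p :: R) = S (cpair (enc_rule p) (enc_trs R)).
Proof. now destruct p. Qed.

Lemma enc_trs_inj R R' : enc_trs R = enc_trs R' -> R = R'.
Proof.
  revert R'. induction R as [|p R IH]; intros [|q R'] E; rewrite ?enc_trs_cons in E;
    try discriminate; auto.
  apply eq_add_S, cpair_inj in E as [E1 E2]. f_equal; auto using enc_rule_inj.
Qed.

Lemma enc_trs_surj n : exists R, enc_trs R = n.
Proof.
  induction n as [n IH] using lt_wf_ind. destruct n as [|n]; [now exists []|].
  pose proof (cpair_pi n) as E. pose proof (cpair_le (pi1 n) (pi2 n)) as [_ L].
  destruct (IH (pi2 n)) as [R HR]; [lia|].
  destruct (enc_term_surj (pi1 (pi1 n))) as [l Hl].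
  destruct (enc_term_surj (pi2 (pi1 n))) as [r Hr].
  exists ((l, r) :: R). rewrite enc_trs_cons. unfold enc_rule; cbn [fst snd].
  now rewrite Hl, Hr, cpair_pi, HR, E.
Qed.

Arguments enc_trs : simpl never.

Lemma enc_pair_inj R t R' t' : enc_pair R t = enc_pair R' t' -> R = R' /\ t = t'.
Proof.
  intros E; apply cpair_inj in E as [E1 E2]; auto using enc_trs_inj, enc_term_inj.
Qed.

Lemma enc_pair_surj n : exists R t, enc_pair R t = n.
Proof.
  destruct (enc_trs_surj (pi1 n)) as [R HR]. destruct (enc_term_surj (pi2 n)) as [t Ht].
  exists R, t. unfold enc_pair. now rewrite HR, Ht, cpair_pi.
Qed.

(** * Horn clauses over codes *)

(** The constructors are the operations that build codes; [PD] and [PS] give the two parities of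
    variables and applications. *)
Inductive pat : Type :=
| PV : nat -> pat
| PK : nat -> pat
| PP : pat -> pat -> pat
| PS : pat -> pat
| PD : pat -> pat.

Fixpoint inst (rho : nat -> nat) (p : pat) : nat :=
  match p with
  | PV i => rho i
  | PK n => n
  | PP a b => cpair (inst rho a) (inst rho b)
  | PS a => S (inst rho a)
  | PD a => 2 * inst rho a
  end.

Definition clause : Type := (pat * pat * pat)%type.

(* The atom 0 is the true one: it fills the unused premises of a clause. *)
Inductive derivable (P : list clause) : nat -> Prop :=
| der_true : derivable P 0
| der_clause i h b1 b2 rho :
    nth_error P i = Some (h, b1, b2) ->
    derivable P (inst rho b1) -> derivable P (inst rho b2) -> derivable P (inst rho h).

(** Every number is read as an infinite sequence, so an arbitrary oracle number already supplies an
    assignment. *)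
Definition env (p i : nat) : nat := pi1 (Nat.iter i pi2 p).

Fixpoint env_code (f : nat -> nat) (n : nat) : nat :=
  match n with 0 => 0 | S m => cpair (f 0) (env_code (fun i => f (S i)) m) end.

Lemma env_env_code f n i : i < n -> env (env_code f n) i = f i.
Proof.
  revert f i. induction n as [|n IH]; intros f [|i] H; try lia; unfold env in *.
  - apply pi1_cpair.
  - rewrite Nat.iter_succ_r. cbn [env_code]. rewrite pi2_cpair, IH by lia. reflexivity.
Qed.

Fixpoint pat_bound (p : pat) : nat :=
  match p with
  | PV i => S i
  | PK _ => 0
  | PP a b => max (pat_bound a) (pat_bound b)
  | PS a | PD a => pat_bound a
  end.

Lemma inst_ext rho rho' p :
  (forall i, i < pat_bound p -> rho i = rho' i) -> inst rho p = inst rho' p.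
Proof.
  induction p; cbn; intros H; auto.
  rewrite IHp1, IHp2; auto; intros; apply H; lia.
Qed.

(** A matched goal is replaced by its two premises. The recursion is on the clause list, so for
    fixed [P] it unfolds to finitely many nested [ifz], which gives computability. *)
Fixpoint resolve (P : list clause) (i p g rest : nat) : nat :=
  match P with
  | [] => S (cpair g rest)
  | (h, b1, b2) :: P' =>
      ifz i
        (ifz (neqz g (inst (env p) h))
           (S (cpair (inst (env p) b1) (S (cpair (inst (env p) b2) rest))))
           (S (cpair g rest)))
        (resolve P' (pred i) p g rest)
  end.

(* A state is an agenda of goals paired with a stream of oracle answers
   (clause index, parameters); a wrong answer leaves the agenda unchanged. *)
Definition advance (P : list clause) (s : nat) : nat :=
  let a := pi1 s in
  let w := pi2 s in
  let g := pi1 (pred a) in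
  let rest := pi2 (pred a) in
  ifz a s
    (ifz g (cpair rest w)
       (cpair (resolve P (pi1 (pi1 w)) (pi2 (pi1 w)) g rest) (pi2 w))).

(** [cert] pairs the number of rounds with the oracle stream; the value 0 means that every goal has
    been discharged. *)
Definition residue (P : list clause) (a cert : nat) : nat :=
  pi1 (nat_rect (fun _ => nat) (cpair a (pi2 cert)) (fun _ s => advance P s) (pi1 cert)).

Lemma cf_inst F p : cf F -> cf (fun v => inst (env (F v)) p).
Proof.
  intros HF. induction p; cbn [inst]; cf_solve.
  induction n; cbn; cf_solve.
Qed.

Lemma cf_resolve P I F G R :
  cf I -> cf F -> cf G -> cf R -> cf (fun v => resolve P (I v) (F v) (G v) (R v)).
Proof.
  intros HI HF HG HR. revert I HI.
  induction P as [|[[h b1] b2] P IH]; intros I HI; cbn [resolve]; cf_solve.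
  1-3: now apply cf_inst.
  apply (IH (fun v => pred (I v))). cf_solve.
Qed.

Lemma cf_residue P F G : cf F -> cf G -> cf (fun v => residue P (F v) (G v)).
Proof.
  intros HF HG. apply cf_pi1.
  apply (cf_rec (fun a => a) (fun _ s _ => advance P s) (cf_proj 0))
    with (N := fun v => pi1 (G v)) (A := fun v => cpair (F v) (pi2 (G v))); cf_solve.
  unfold advance. cf_solve. apply cf_resolve; cf_solve.
Qed.

Fixpoint agenda (gs : list nat) : nat :=
  match gs with [] => 0 | g :: gs' => S (cpair g (agenda gs')) end.

Inductive all_derivable (P : list clause) : nat -> Prop :=
| all_nil : all_derivable P 0
| all_cons g r : derivable P g -> all_derivable P r -> all_derivable P (S (cpair g r)).

Lemma all_derivable_S P g r :
  all_derivable P (S (cpair g r)) -> derivable P g /\ all_derivable P r.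
Proof.
  inversion 1 as [|g' r' H1 H2 E]. apply cpair_inj in E as [-> ->]. auto.
Qed.

(** [Q] runs through the suffixes of [P] in the induction, while derivability stays relative to
    [P]. *)
Lemma resolve_sound P Q i p g r :
  (forall j c, nth_error Q j = Some c -> exists k, nth_error P k = Some c) ->
  all_derivable P (resolve Q i p g r) -> all_derivable P (S (cpair g r)).
Proof.
  revert i. induction Q as [|[[h b1] b2] Q IH]; cbn [resolve]; intros i HQ H; auto.
  destruct i as [|i].
  - rewrite ifz_0 in H. destruct (neqz g (inst (env p) h)) eqn:E.
    + rewrite ifz_0 in H. unfold neqz in E.
      replace g with (inst (env p) h) by lia.
      apply all_derivable_S in H as [H1 H]. apply all_derivable_S in H as [H2 H].
      destruct (HQ 0 _ eq_refl) as [k Hk].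
      constructor; auto. eapply der_clause; eauto.
    + rewrite ifz_S in H. exact H.
  - rewrite ifz_S in H. apply (IH i); auto. intros j. apply (HQ (S j)).
Qed.

Lemma resolve_complete Q i p h b1 b2 r :
  nth_error Q i = Some (h, b1, b2) ->
  resolve Q i p (inst (env p) h) r =
  S (cpair (inst (env p) b1) (S (cpair (inst (env p) b2) r))).
Proof.
  revert i. induction Q as [|[[h' b1'] b2'] Q IH]; intros [|i] H; try discriminate; cbn [resolve].
  - injection H as -> -> ->. rewrite ifz_0. unfold neqz. rewrite Nat.sub_diag. apply ifz_0.
  - rewrite ifz_S. apply IH, H.
Qed.

Lemma advance_true P r w : advance P (cpair (S (cpair 0 r)) w) = cpair r w.
Proof.
  unfold advance. rewrite !pi1_cpair, pi2_cpair, ifz_S. cbn [pred].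
  now rewrite pi1_cpair, pi2_cpair, ifz_0.
Qed.

Lemma advance_S P g r w :
  advance P (cpair (S (cpair (S g) r)) w) =
  cpair (resolve P (pi1 (pi1 w)) (pi2 (pi1 w)) (S g) r) (pi2 w).
Proof.
  unfold advance. rewrite !pi1_cpair, pi2_cpair, ifz_S. cbn [pred].
  now rewrite pi1_cpair, pi2_cpair, ifz_S.
Qed.

(** Soundness works backwards: the empty agenda at the end passes derivability to every earlier
    agenda. *)
Lemma advance_sound P s : all_derivable P (pi1 (advance P s)) -> all_derivable P (pi1 s).
Proof.
  rewrite <- (cpair_pi s). generalize (pi1 s) (pi2 s). clear s. intros a w.
  rewrite pi1_cpair. destruct a as [|a]; [constructor|].
  rewrite <- (cpair_pi a). generalize (pi1 a) (pi2 a). clear a. intros [|g] r.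
  - rewrite advance_true, pi1_cpair. repeat constructor. assumption.
  - rewrite advance_S, pi1_cpair. apply resolve_sound. eauto.
Qed.

Definition solvable (P : list clause) (a : nat) : Prop :=
  exists k w, pi1 (Nat.iter k (advance P) (cpair a w)) = 0.

(** Generality in the remaining agenda [r] chains the oracle answers: those for the second premise
    and for [r] continue those for the first premise. *)
Lemma derivable_solvable P g :
  derivable P g -> forall r, solvable P r -> solvable P (S (cpair g r)).
Proof.
  induction 1 as [|i h b1 b2 rho Hi _ IH1 _ IH2]; intros r Hr.
  - destruct Hr as (k & w & H). exists (S k), w.
    now rewrite Nat.iter_succ_r, advance_true.
  - destruct (inst rho h) as [|g] eqn:Eg.
    { destruct Hr as (k & w & H). exists (S k), w. now rewrite Nat.iter_succ_r, advance_true. }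
    destruct (IH1 _ (IH2 _ Hr)) as (k & w & H).
    (* A prefix of [rho] of length [n] determines the instances of all three patterns, so the oracle
       need only code that prefix. *)
    set (n := max (pat_bound h) (max (pat_bound b1) (pat_bound b2))).
    assert (E : forall q, pat_bound q <= n -> inst (env (env_code rho n)) q = inst rho q).
    { intros q Hq. apply inst_ext. intros j Hj. apply env_env_code. lia. }
    exists (S k), (cpair (cpair i (env_code rho n)) w).
    rewrite Nat.iter_succ_r, advance_S, !pi1_cpair, !pi2_cpair, <- Eg.
    rewrite <- (E h), (resolve_complete _ _ _ _ b1 b2), !E; auto; subst n; lia.
Qed.

Lemma residue_iff P gs :
  (exists cert, residue P (agenda gs) cert = 0) <-> Forall (derivable P) gs.
Proof.
  split.
  - intros [cert H]. unfold residue in H.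
    assert (HA : all_derivable P (agenda gs)).
    { rewrite <- (pi1_cpair (agenda gs) (pi2 cert)).
      revert H. generalize (cpair (agenda gs) (pi2 cert)) as s.
      induction (pi1 cert) as [|k IH]; intros s H.
      - cbn [nat_rect] in H. rewrite H. constructor.
      - apply advance_sound, IH. rewrite <- H.
        (* [nat_rect] adds rounds at the end, whereas the invariant is pulled back through the first
           round. *)
        apply f_equal. symmetry. exact (Nat.iter_succ_r k _ (advance P) s). }
    clear H. induction gs as [|g gs IH]; constructor;
      apply all_derivable_S in HA as [H1 H2]; auto.
  - intros H. assert (HS : solvable P (agenda gs)).
    { induction H; [exists 0, 0; apply pi1_cpair|].
      now apply derivable_solvable. }
    destruct HS as (k & w & HS). exists (cpair k w). unfold residue.
    rewrite pi1_cpair, pi2_cpair. exact HS.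
Qed.

(** * Rewriting as a Horn theory *)

(** Substitution, single steps and occurrence speak of lists: a singleton stands for a term, and the
    same judgment then covers the arguments of a symbol. *)
Inductive judgment : Type :=
| JIn (p : rule) (R : trs)
| JLookup (s : list term) (x : nat) (t : term)
| JSubst (s l m : list term)
| JStep (R : trs) (l m : list term)
| JSteps (R : trs) (s t : term)
| JVars (l m : list term)
| JOccurs (x : nat) (l : list term)
| JWf (R : trs).

(* A list of terms serves as the substitution of its entries for the variables 0, 1, ... *)
Definition subst_of (s : list term) (x : nat) : term := nth x s (Var 0).

Definition holds (j : judgment) : Prop :=
  match j with
  | JIn p R => In p R
  | JLookup s x t => nth_error s x = Some t
  | JSubst s l m => m = map (subst (subst_of s)) l
  | JStep R l m => exists a s t b, l = a ++ s :: b /\ m = a ++ t :: b /\ step R s t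
  | JSteps R s t => steps R s t
  | JVars l m => forall x, In x (flat_map vars l) -> In x (flat_map vars m)
  | JOccurs x l => In x (flat_map vars l)
  | JWf R => wf_trs R
  end.

(** Tags start at 1 because the true atom 0 equals [cpair 0 0]. *)
Definition enc_judgment (j : judgment) : nat :=
  match j with
  | JIn p R => cpair 1 (cpair (enc_rule p) (enc_trs R))
  | JLookup s x t => cpair 2 (cpair (enc_list s) (cpair x (enc_term t)))
  | JSubst s l m => cpair 3 (cpair (enc_list s) (cpair (enc_list l) (enc_list m)))
  | JStep R l m => cpair 4 (cpair (enc_trs R) (cpair (enc_list l) (enc_list m)))
  | JSteps R s t => cpair 5 (cpair (enc_trs R) (cpair (enc_term s) (enc_term t)))
  | JVars l m => cpair 6 (cpair (enc_list l) (enc_list m))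
  | JOccurs x l => cpair 7 (cpair x (enc_list l))
  | JWf R => cpair 8 (enc_trs R)
  end.

Definition pcons (a l : pat) : pat := PS (PP a l).
Definition pfn (f l : pat) : pat := PS (PD (PP f l)).
Definition patom (n : nat) (p : pat) : pat := PP (PK n) p.

Definition rewriting : list clause :=
  (* [s] and [R] share variable 0: no clause mentions both. *)
  let nil := PK 0 in
  let true := PK 0 in
  let R := PV 0 in let s := PV 0 in
  let a := PV 1 in let l := PV 2 in let b := PV 3 in let m := PV 4 in
  let f := PV 5 in let k := PV 6 in let n := PV 7 in
  let isin p R := patom 1 (PP p R) in
  let lookup s x t := patom 2 (PP s (PP x t)) in
  let sub s l m := patom 3 (PP s (PP l m)) in
  let stp R l m := patom 4 (PP R (PP l m)) in
  let stps R a b := patom 5 (PP R (PP a b)) in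
  let vrs l m := patom 6 (PP l m) in
  let occ x l := patom 7 (PP x l) in
  let wf R := patom 8 R in
  [ (isin a (pcons a l), true, true);
    (isin a (pcons b l), isin a l, true);
    (lookup (pcons a l) (PK 0) a, true, true);
    (lookup (pcons b l) (PS n) a, lookup l n a, true);
    (sub s nil nil, true, true);
    (* Even codes are variables and odd ones applications, so [PD] and [pfn] split on the head
       term. *)
    (sub s (pcons (PD n) l) (pcons b m), lookup s n b, sub s l m);
    (sub s (pcons (pfn f k) l) (pcons (pfn f n) m), sub s k n, sub s l m);
    (* Root step: [f], [k] are the sides of the rule and [n] is the substitution. *)
    (stp R (pcons a l) (pcons b l),
     isin (PP f k) R, sub n (pcons f (pcons k nil)) (pcons a (pcons b nil)));
    (stp R (pcons (pfn f k) l) (pcons (pfn f n) l), stp R k n, true);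
    (stp R (pcons a l) (pcons a m), stp R l m, true);
    (stps R a a, true, true);
    (stps R a b, stp R (pcons a nil) (pcons k nil), stps R k b);
    (vrs nil m, true, true);
    (vrs (pcons (PD n) l) m, occ n m, vrs l m);
    (vrs (pcons (pfn f k) l) m, vrs k m, vrs l m);
    (occ n (pcons (PD n) l), true, true);
    (occ n (pcons (pfn f k) l), occ n k, true);
    (occ n (pcons a l), occ n l, true);
    (wf nil, true, true);
    (* The pattern [pfn] excludes rules whose left-hand side is a variable. *)
    (wf (pcons (PP (pfn f k) b) l),
     vrs (pcons b nil) (pcons (pfn f k) nil), wf l) ].

(** Turns equations between codes into equations between the coded objects; tags and parity refute
    the clauses that cannot apply. *)
Ltac break :=
  repeat match goal with
  | H : cpair _ _ = cpair _ _ |- _ =>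
      let H1 := fresh in let H2 := fresh in
      apply cpair_inj in H; destruct H as [H1 H2]; try discriminate H1
  | H : S _ = S _ |- _ => apply eq_add_S in H
  | H : 0 = S _ |- _ => discriminate H
  | H : S _ = 0 |- _ => discriminate H
  | H : 2 * _ = S (2 * _) |- _ => exfalso; lia
  | H : S (2 * _) = 2 * _ |- _ => exfalso; lia
  | H : 2 * _ = 2 * _ |- _ => apply Nat.mul_cancel_l in H; [|discriminate]
  | H : 0 = enc_list ?l |- _ => destruct l; cbn [enc_list] in H
  | H : S _ = enc_list ?l |- _ => destruct l; cbn [enc_list] in H
  | H : 0 = enc_trs ?R |- _ =>
      destruct R; [clear H|rewrite enc_trs_cons in H]
  | H : S _ = enc_trs ?R |- _ =>
      destruct R; [discriminate H|rewrite enc_trs_cons in H]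
  | H : cpair _ _ = enc_rule ?p |- _ => destruct p; unfold enc_rule in H; cbn [fst snd] in H
  | H : S _ = enc_term ?t |- _ => destruct t; rewrite ?enc_Var, ?enc_Fn in H
  | H : 2 * _ = enc_term ?t |- _ => destruct t; rewrite ?enc_Var, ?enc_Fn in H
  | H : ?x = enc_term ?s, H' : ?x = enc_term ?t |- _ =>
      tryif constr_eq s t then clear H' else
      (assert (s = t) by (apply enc_term_inj; congruence); subst t)
  | H : ?x = enc_list ?s, H' : ?x = enc_list ?t |- _ =>
      tryif constr_eq s t then clear H' else
      (assert (s = t) by (apply enc_list_inj; congruence); subst t)
  | H : ?x = enc_rule ?s, H' : ?x = enc_rule ?t |- _ =>
      tryif constr_eq s t then clear H' else
      (assert (s = t) by (apply enc_rule_inj; congruence); subst t)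
  end.

Ltac premise IH j H :=
  assert (H : holds j) by
    (apply IH; cbn [enc_judgment enc_list]; rewrite ?enc_Var, ?enc_Fn;
     first [congruence | unfold enc_rule; cbn [fst snd]; congruence]);
  cbn [holds] in H.

(** Each clause preserves [holds]: injectivity of the coding reads the judgment off the head, and
    the premises are judgments again. *)
Lemma rewriting_sound g :
  derivable rewriting g -> forall j, g = enc_judgment j -> holds j.
Proof.
  induction 1 as [|i h b1 b2 rho Hi _ IH1 _ IH2]; intros j Ej.
  { destruct j; cbn in Ej; change 0 with (cpair 0 0) in Ej; break. }
  apply nth_error_In in Hi. cbn [rewriting] in Hi.
  repeat (destruct Hi as [Hi|Hi]; [injection Hi as <- <- <-|]); [..|destruct Hi].
  all: cbn [inst pcons pfn patom] in *.
  all: destruct j; cbn [enc_judgment] in Ej; break; cbn [holds].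
  - now left.
  - premise IH1 (JIn p R) HP. now right.
  - subst x. reflexivity.
  - subst x. premise IH1 (JLookup s (rho 7) t) HP. exact HP.
  - reflexivity.
  - premise IH1 (JLookup s n t) HP. premise IH2 (JSubst s l m) HQ.
    cbn. f_equal; auto. symmetry. now apply nth_error_nth.
  - premise IH1 (JSubst s l1 l0) HP. premise IH2 (JSubst s l m) HQ.
    cbn. congruence.
  (* The rule and the substitution occur only in the premises, so surjectivity of the coding has to
     decode them. *)
  - destruct (enc_list_surj (rho 7)) as [s Hs].
    destruct (enc_term_surj (rho 5)) as [u Hu]. destruct (enc_term_surj (rho 6)) as [v Hv].
    premise IH1 (JIn (u, v) R) HP. premise IH2 (JSubst s [u; v] [t0; t]) HQ.
    injection HQ as -> ->. exists [], (subst (subst_of s) u), (subst (subst_of s) v), l.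
    repeat split; auto. now constructor.
  - premise IH1 (JStep R l1 l0) HP. destruct HP as (a & s & t & b & -> & -> & HP).
    exists [], (Fn n0 (a ++ s :: b)), (Fn n0 (a ++ t :: b)), l.
    replace n with n0 by congruence. repeat split. now constructor.
  - premise IH1 (JStep R l m) HP. destruct HP as (a & s & t & b & -> & -> & HP).
    now exists (t0 :: a), s, t, b.
  - apply rt_refl.
  - destruct (enc_term_surj (rho 6)) as [u Hu].
    premise IH1 (JStep R [s] [u]) HP. premise IH2 (JSteps R u t) HQ.
    (* A splitting of a singleton leaves nothing around the rewritten term, so the list step is a
       term step. *)
    destruct HP as ([|? []] & s' & t' & b & E1 & E2 & HP); try discriminate.
    injection E1 as <- <-. injection E2 as <-.
    eapply rt_trans; [apply rt_step|]; eauto.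
  - intros x [].
  - premise IH1 (JOccurs n m) HP. premise IH2 (JVars l m) HQ. cbn.
    intros x [<-|Hx]; auto.
  - premise IH1 (JVars l0 m) HP. premise IH2 (JVars l m) HQ. cbn [flat_map].
    intros x Hx. rewrite vars_Fn in Hx. apply in_app_or in Hx as [Hx|Hx]; auto.
  - left. congruence.
  - premise IH1 (JOccurs x l0) HP. cbn [flat_map]. rewrite vars_Fn. apply in_or_app; auto.
  - premise IH1 (JOccurs x l) HP. apply in_or_app; auto.
  - intros ? [].
  - premise IH1 (JVars [t0] [Fn n l]) HP. premise IH2 (JWf R) HQ.
    intros p [<-|Hp]; auto. cbn [flat_map] in HP. rewrite !app_nil_r in HP.
    split; auto. discriminate.
Qed.

(** * Derivability of the true judgments *)

Definition provable (j : judgment) : Prop := derivable rewriting (enc_judgment j).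

Lemma derive i rho h b1 b2 g :
  nth_error rewriting i = Some (h, b1, b2) -> g = inst rho h ->
  derivable rewriting (inst rho b1) -> derivable rewriting (inst rho b2) ->
  derivable rewriting g.
Proof. intros Hi -> H1 H2. eapply der_clause; eauto. Qed.

(** Applies clause number [i] of [rewriting]; [ps] lists the values of the pattern variables 0, 1,
    ..., with 0 at positions that the clause does not mention. *)
Ltac horn i ps :=
  eapply (derive i (fun k => nth k ps 0));
  [ reflexivity
  | cbn; rewrite ?enc_trs_cons; unfold enc_rule; cbn [fst snd]; rewrite ?enc_Fn; reflexivity
  | cbn; try apply der_true; try assumption
  | cbn; try apply der_true; try assumption ].

Lemma provable_in p R : In p R -> provable (JIn p R).
Proof.
  induction R as [|q R IH]; intros []; unfold provable in *.
  - subst q. horn 0 [0; enc_rule p; enc_trs R].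
  - horn 1 [0; enc_rule p; enc_trs R; enc_rule q]. now apply IH.
Qed.

Lemma provable_lookup s x t : nth_error s x = Some t -> provable (JLookup s x t).
Proof.
  revert x. induction s as [|a s IH]; intros [|x] E; try discriminate; unfold provable in *.
  - injection E as ->. horn 2 [0; enc_term t; enc_list s].
  - horn 3 [0; enc_term t; enc_list s; enc_term a; 0; 0; 0; x]. now apply IH.
Qed.

Lemma provable_subst_list s l :
  Forall (fun a => forall l m, provable (JSubst s l m) ->
                   provable (JSubst s (a :: l) (subst (subst_of s) a :: m))) l ->
  provable (JSubst s l (map (subst (subst_of s)) l)).
Proof.
  induction 1 as [|a l Ha _ IH]; [horn 4 [enc_list s]|]. now apply Ha.
Qed.

(** [JLookup] derives only entries present in [s], so [s] has to reach beyond every variable of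
    [a]. *)
Lemma provable_subst_cons s a :
  (forall x, In x (vars a) -> x < length s) ->
  forall l m, provable (JSubst s l m) ->
  provable (JSubst s (a :: l) (subst (subst_of s) a :: m)).
Proof.
  induction a as [x|f k IH] using term_rect'; intros Ha l m H; unfold provable.
  - horn 5 [enc_list s; 0; enc_list l; enc_term (subst_of s x); enc_list m; 0; 0; x].
    apply provable_lookup, nth_error_nth', Ha. now left.
  - horn 6 [enc_list s; 0; enc_list l; 0; enc_list m; f; enc_list k;
            enc_list (map (subst (subst_of s)) k)].
    apply provable_subst_list. rewrite Forall_forall in *. intros a Hin. apply IH; auto.
    intros x Hx. apply Ha. rewrite vars_Fn, in_flat_map. eauto.
Qed.

Lemma subst_ext s s' t : (forall x, In x (vars t) -> s x = s' x) -> subst s t = subst s' t.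
Proof.
  induction t as [x|f l IH] using term_rect'; cbn [subst]; intros H.
  - apply H. now left.
  - f_equal. rewrite Forall_forall in IH. apply map_ext_in. intros a Ha. apply IH; auto.
    intros x Hx. apply H. rewrite vars_Fn, in_flat_map. eauto.
Qed.

Lemma provable_root R l r sigma :
  In (l, r) R -> forall m, provable (JStep R (subst sigma l :: m) (subst sigma r :: m)).
Proof.
  intros Hin m.
  (* [N] exceeds every variable of the rule, so the first [N] values of [sigma], kept as a list, act
     on it like [sigma]. *)
  set (N := S (list_max (vars l ++ vars r))). set (s := map sigma (seq 0 N)).
  assert (HN : forall x, In x (vars l ++ vars r) -> x < N).
  { intros x Hx. pose proof (proj1 (list_max_le (vars l ++ vars r) _) (le_n _)) as HF.
    rewrite Forall_forall in HF. apply HF in Hx. unfold N. lia. }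
  assert (Hs : forall x, x < N -> sigma x = subst_of s x).
  { intros x Hx. unfold subst_of, s.
    rewrite (nth_indep _ _ (sigma 0)) by (rewrite length_map, length_seq; auto).
    now rewrite map_nth, seq_nth. }
  assert (Hlen : length s = N) by (unfold s; now rewrite length_map, length_seq).
  rewrite (subst_ext sigma (subst_of s) l), (subst_ext sigma (subst_of s) r)
    by (intros; apply Hs, HN, in_or_app; auto).
  unfold provable.
  horn 7 [enc_trs R; enc_term (subst (subst_of s) l); enc_list m;
          enc_term (subst (subst_of s) r); 0; enc_term l; enc_term r; enc_list s].
  - apply (provable_in _ _ Hin).
  - apply (provable_subst_list s [l; r]).
    repeat constructor; apply provable_subst_cons; rewrite Hlen;
      intros; apply HN, in_or_app; auto.
Qed.

Lemma provable_step R s t : step R s t -> forall m, provable (JStep R (s :: m) (t :: m)).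
Proof.
  induction 1 as [l r sigma Hin|f a b s t _ IH]; [now apply provable_root|].
  intros m. unfold provable.
  horn 8 [enc_trs R; 0; enc_list m; 0; 0; f; enc_list (a ++ s :: b); enc_list (a ++ t :: b)].
  induction a as [|c a IHa]; [apply IH|]. cbn [app].
  horn 9 [enc_trs R; enc_term c; enc_list (a ++ s :: b); 0; enc_list (a ++ t :: b)].
Qed.

Lemma provable_steps R s t : steps R s t -> provable (JSteps R s t).
Proof.
  intros H. apply clos_rt_rt1n in H. unfold provable.
  induction H as [s|s u t H _ IH].
  - horn 10 [enc_trs R; enc_term s].
  - horn 11 [enc_trs R; enc_term s; 0; enc_term t; 0; 0; enc_term u].
    apply (provable_step _ _ _ H []).
Qed.

Lemma provable_occurs_cons x a :
  In x (vars a) -> forall l, provable (JOccurs x (a :: l)).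
Proof.
  induction a as [y|f k IH] using term_rect'; intros H l; unfold provable.
  - destruct H as [->|[]]. horn 15 [0; 0; enc_list l; 0; 0; 0; 0; x].
  - horn 16 [0; 0; enc_list l; 0; 0; f; enc_list k; x]. rewrite vars_Fn in H.
    induction IH as [|a k Ha _ IHk]; [destruct H|].
    cbn in H. apply in_app_or in H as [H|H]; [now apply Ha|].
    horn 17 [0; enc_term a; enc_list k; 0; 0; 0; 0; x]. auto.
Qed.

Lemma provable_occurs x l : In x (flat_map vars l) -> provable (JOccurs x l).
Proof.
  intros H. apply in_flat_map in H as (a & Ha & Hx). apply in_split in Ha as (k & m & ->).
  induction k as [|b k IH]; [now apply provable_occurs_cons|]. unfold provable. cbn [app].
  horn 17 [0; enc_term b; enc_list (k ++ a :: m); 0; 0; 0; 0; x].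
Qed.

Lemma provable_vars_list l m :
  Forall (fun a => forall l, provable (JVars l m) -> provable (JVars (a :: l) m)) l ->
  provable (JVars l m).
Proof.
  induction 1 as [|a l Ha _ IH]; [horn 12 [0; 0; 0; 0; enc_list m]|]. now apply Ha.
Qed.

Lemma provable_vars_cons m a :
  (forall x, In x (vars a) -> In x (flat_map vars m)) ->
  forall l, provable (JVars l m) -> provable (JVars (a :: l) m).
Proof.
  induction a as [x|f k IH] using term_rect'; intros Ha l H; unfold provable.
  - horn 13 [0; 0; enc_list l; 0; enc_list m; 0; 0; x].
    apply provable_occurs, Ha. now left.
  - horn 14 [0; 0; enc_list l; 0; enc_list m; f; enc_list k].
    apply provable_vars_list. rewrite Forall_forall in *. intros a Hin. apply IH; auto.
    intros x Hx. apply Ha. rewrite vars_Fn, in_flat_map. eauto.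
Qed.

Lemma provable_vars l m :
  (forall x, In x (flat_map vars l) -> In x (flat_map vars m)) -> provable (JVars l m).
Proof.
  intros H. apply provable_vars_list, Forall_forall. intros a Ha.
  apply provable_vars_cons. intros x Hx. apply H, in_flat_map. eauto.
Qed.

Lemma provable_wf R : wf_trs R -> provable (JWf R).
Proof.
  unfold provable. induction R as [|[l r] R IH]; intros H; [horn 18 [0]|].
  destruct (H (l, r)) as [Hl Hr]; [now left|]. cbn [fst snd] in *.
  destruct l as [x|f k]; [now destruct (Hl x)|].
  horn 19 [0; 0; enc_trs R; enc_term r; 0; f; enc_list k].
  - rewrite <- enc_Fn. apply (provable_vars [r] [Fn f k]). cbn. now rewrite !app_nil_r.
  - apply IH. intros p Hp. apply H. now right.
Qed.

(** The restriction matters: [JSubst] may hold through the default [Var 0] of [subst_of] for a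
    variable beyond the list, where no lookup is derivable. *)
Lemma provable_iff j :
  match j with JSteps _ _ _ | JVars _ _ | JWf _ => True | _ => False end ->
  provable j <-> holds j.
Proof.
  intros Hj. split; [intros H; now apply rewriting_sound with (1 := H)|].
  destruct j; destruct Hj; auto using provable_steps, provable_vars, provable_wf.
Qed.

(** * Membership of confluence on a term in the class [Pi02] *)

Lemma Pi02_confluent (Q : term -> Prop) (q : nat -> nat) :
  (forall F, cf F -> cf (fun v => q (F v))) ->
  (forall t, derivable rewriting (q (enc_term t)) <-> Q t) ->
  Pi02 (fun n => exists R t, n = enc_pair R t /\ wf_trs R /\ Q t /\ confluent_on R t).
Proof.
  intros Hq HQ.
  set (goal r a b := cpair 5 (cpair r (cpair a b))).
  (* [x] packs two reducts with a certificate for both reductions. *)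
  set (peak n x := residue rewriting
    (agenda [goal (pi1 n) (pi2 n) (pi1 (pi1 x)); goal (pi1 n) (pi2 n) (pi2 (pi1 x))]) (pi2 x)).
  (* [y] packs a common reduct with a certificate. Well-formedness and [Q] are certified by
     derivations too, so they join this existential side. *)
  set (valley n x y := residue rewriting
    (agenda [cpair 8 (pi1 n); q (pi2 n);
             goal (pi1 n) (pi1 (pi1 x)) (pi1 y); goal (pi1 n) (pi2 (pi1 x)) (pi1 y)]) (pi2 y)).
  exists (fun n x y => peak n x = 0 -> valley n x y = 0). split.
  (* With 0 as truth, the implication takes the value of [valley] where [peak] vanishes and 0
     elsewhere. *)
  - assert (cf (fun v => ifz (peak (nth 0 v 0) (nth 1 v 0))
                             (valley (nth 0 v 0) (nth 1 v 0) (nth 2 v 0)) 0)) as [c Hc].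
    { unfold peak, valley, goal. cbn [agenda].
      apply cf_ifz; [apply cf_residue| apply cf_residue|]; cf_solve. apply Hq; cf_solve. }
    exists c. intros n x y. eexists. split; [apply Hc|]. cbn [nth].
    destruct (peak n x).
    + rewrite ifz_0. tauto.
    + rewrite ifz_S. split; auto. discriminate.
  - assert (Hpeak : forall R t t1 t2 w,
      peak (enc_pair R t) (cpair (cpair (enc_term t1) (enc_term t2)) w) =
      residue rewriting (agenda [enc_judgment (JSteps R t t1); enc_judgment (JSteps R t t2)]) w).
    { intros. unfold peak, enc_pair. now rewrite !pi1_cpair, !pi2_cpair. }
    assert (Hvalley : forall R t t1 t2 d w w',
      valley (enc_pair R t) (cpair (cpair (enc_term t1) (enc_term t2)) w)
             (cpair (enc_term d) w') =
      residue rewriting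
        (agenda [enc_judgment (JWf R); q (enc_term t);
                 enc_judgment (JSteps R t1 d); enc_judgment (JSteps R t2 d)]) w').
    { intros. unfold valley, enc_pair. now rewrite !pi1_cpair, !pi2_cpair. }
    assert (Hsteps : forall R s t, provable (JSteps R s t) <-> steps R s t)
      by (intros R s t; exact (provable_iff (JSteps R s t) I)).
    assert (Hwf : forall R, provable (JWf R) <-> wf_trs R)
      by (intros R; exact (provable_iff (JWf R) I)).
    assert (Hjoin : forall R t t1 t2 w,
      (exists y, valley (enc_pair R t) (cpair (cpair (enc_term t1) (enc_term t2)) w) y = 0) <->
      wf_trs R /\ Q t /\ exists d, steps R t1 d /\ steps R t2 d).
    { intros R t t1 t2 w. split.
      - intros [y Hy]. rewrite <- (cpair_pi y) in Hy.
        destruct (enc_term_surj (pi1 y)) as [d Hd]. rewrite <- Hd, Hvalley in Hy.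
        assert (HF := proj1 (residue_iff _ _) (ex_intro _ _ Hy)).
        apply Forall_cons_iff in HF as [H1 HF]. apply Forall_cons_iff in HF as [H2 HF].
        apply Forall_cons_iff in HF as [H3 HF]. apply Forall_cons_iff in HF as [H4 _].
        apply Hwf in H1. apply HQ in H2. apply Hsteps in H3, H4. eauto.
      - intros (H1 & H2 & d & H3 & H4).
        apply Hwf in H1. apply HQ in H2. apply Hsteps in H3, H4.
        destruct (proj2 (residue_iff rewriting
          [enc_judgment (JWf R); q (enc_term t);
           enc_judgment (JSteps R t1 d); enc_judgment (JSteps R t2 d)])) as [w' Hw'];
          [repeat constructor; assumption|].
        exists (cpair (enc_term d) w'). now rewrite Hvalley. }
    intros n. destruct (enc_pair_surj n) as (R & t & <-). split.
    + intros (R' & t' & E & H1 & H2 & H3) x. apply enc_pair_inj in E as [<- <-].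
      rewrite <- (cpair_pi x), <- (cpair_pi (pi1 x)).
      destruct (enc_term_surj (pi1 (pi1 x))) as [t1 <-].
      destruct (enc_term_surj (pi2 (pi1 x))) as [t2 <-].
      (* If [x] certifies no peak, any [y] will do. *)
      destruct (Nat.eq_dec (peak (enc_pair R t)
        (cpair (cpair (enc_term t1) (enc_term t2)) (pi2 x))) 0) as [E|E]; [|exists 0; tauto].
      rewrite Hpeak in E. assert (HF := proj1 (residue_iff _ _) (ex_intro _ _ E)).
      apply Forall_cons_iff in HF as [H4 HF]. apply Forall_cons_iff in HF as [H5 _].
      apply Hsteps in H4, H5. destruct (H3 _ _ H4 H5) as [d [H6 H7]].
      destruct (proj2 (Hjoin R t t1 t2 (pi2 x))) as [y Hy];
        [exact (conj H1 (conj H2 (ex_intro _ d (conj H6 H7))))|].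
      exists y. intros _. exact Hy.
    + intros H.
      assert (HJ : forall t1 t2, steps R t t1 -> steps R t t2 ->
                   wf_trs R /\ Q t /\ exists d, steps R t1 d /\ steps R t2 d).
      { intros t1 t2 H1 H2. apply Hsteps in H1, H2.
        destruct (proj2 (residue_iff rewriting
          [enc_judgment (JSteps R t t1); enc_judgment (JSteps R t t2)])) as [w Hw];
          [repeat constructor; assumption|].
        rewrite <- Hpeak in Hw.
        apply (Hjoin R t t1 t2 w).
        destruct (H (cpair (cpair (enc_term t1) (enc_term t2)) w)) as [y Hy].
        exists y. exact (Hy Hw). }
      (* The trivial peak from [t] to itself forces the side conditions. *)
      destruct (HJ t t) as (H1 & H2 & _); try apply rt_refl.
      exists R, t. split; [reflexivity|split; [exact H1|split; [exact H2|]]].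
      intros t1 t2 H3 H4. now apply HJ.
Qed.

Lemma Pi02_iff A B : (forall n, A n <-> B n) -> Pi02 A -> Pi02 B.
Proof.
  intros H (P & HP & HA). exists P. split; auto. intros n. rewrite <- H. apply HA.
Qed.

Lemma Pi02_CONF_term : Pi02 CONF_term.
Proof.
  apply (Pi02_iff (fun n => exists R t, n = enc_pair R t /\ wf_trs R /\ True /\ confluent_on R t)).
  - intros n. split; intros (R & t & H); exists R, t; tauto.
  - apply (Pi02_confluent _ (fun _ => 0)); intros; [apply cf_const|].
    split; auto. constructor.
Qed.

(* [t] is ground iff its variables occur in the empty list of terms: the atom below is
   the code of [JVars [t] []]. *)
Lemma Pi02_CONF_ground_term : Pi02 CONF_ground_term.
Proof.
  apply (Pi02_confluent ground (fun t => cpair 6 (cpair (S (cpair t 0)) 0))).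
  - intros F HF. cf_solve.
  - intros t. change (provable (JVars [t] []) <-> ground t).
    rewrite (provable_iff (JVars [t] []) I). cbn. rewrite app_nil_r. unfold ground.
    destruct (vars t) as [|x l]; split; auto; intros H; [now destruct (H x); left|discriminate].
Qed.

(** * A rewriting interpreter for [code] *)

Definition tzero := Fn 0 [].
Definition tsucc n := Fn 1 [n].
Definition tnil := Fn 2 [].
Definition tcons x l := Fn 3 [x; l].
Definition stop := Fn 10 [].
(** Each frame records what follows the pending result: [kprec] the step code, [kmu] the candidate
    under test, [kcomp] the outer function, [kargs] the arguments still to evaluate, [kcons] a value
    to put in front. *)
Definition kprec g n v k := Fn 11 [g; n; v; k].
Definition kmu f n v k := Fn 12 [f; n; v; k].
Definition kcomp f k := Fn 13 [f; k].
Definition kargs gs v k := Fn 14 [gs; v; k].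
Definition kcons y k := Fn 15 [y; k].
Definition accept := Fn 16 [].
Definition run c v k := Fn 20 [c; v; k].
Definition ret z k := Fn 21 [z; k].
Definition runs gs v k := Fn 22 [gs; v; k].
Definition rets ys k := Fn 23 [ys; k].
Definition guess c n x := Fn 24 [c; n; x].

Fixpoint tnum (n : nat) : term := match n with 0 => tzero | S m => tsucc (tnum m) end.

Fixpoint tcode (c : code) : term :=
  match c with
  | CZero => Fn 4 []
  | CSucc => Fn 5 []
  | CProj i => Fn 6 [tnum i]
  | CComp f gs => Fn 7 [tcode f; fold_right (fun g => tcons (tcode g)) tnil gs]
  | CPrec f g => Fn 8 [tcode f; tcode g]
  | CMu f => Fn 9 [tcode f]
  end.

Definition tcodes (gs : list code) : term := fold_right (fun g => tcons (tcode g)) tnil gs.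
Fixpoint tlist (v : list nat) : term :=
  match v with [] => tnil | n :: v' => tcons (tnum n) (tlist v') end.

(** The clauses of [eval] in continuation form; the rules for [tnil] reproduce the default 0 of [hd]
    and [nth]. *)
Definition machine : trs :=
  let k := Var 0 in let v := Var 1 in let f := Var 2 in let g := Var 3 in
  let x := Var 4 in let y := Var 5 in
  [ (run (Fn 4 []) v k, ret tzero k);
    (run (Fn 5 []) tnil k, ret (tsucc tzero) k);
    (run (Fn 5 []) (tcons x v) k, ret (tsucc x) k);
    (run (Fn 6 [y]) tnil k, ret tzero k);
    (run (Fn 6 [tzero]) (tcons x v) k, ret x k);
    (run (Fn 6 [tsucc y]) (tcons x v) k, run (Fn 6 [y]) v k);
    (run (Fn 7 [f; g]) v k, runs g v (kcomp f k));
    (run (Fn 8 [f; g]) (tcons tzero v) k, run f v k);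
    (run (Fn 8 [f; g]) (tcons (tsucc x) v) k, run (Fn 8 [f; g]) (tcons x v) (kprec g x v k));
    (run (Fn 9 [f]) v k, run f (tcons tzero v) (kmu f tzero v k));
    (ret y (kprec g x v k), run g (tcons x (tcons y v)) k);
    (ret tzero (kmu f x v k), ret x k);
    (ret (tsucc y) (kmu f x v k), run f (tcons (tsucc x) v) (kmu f (tsucc x) v k));
    (runs tnil v k, rets tnil k);
    (runs (tcons f g) v k, run f v (kargs g v k));
    (ret y (kargs g v k), runs g v (kcons y k));
    (rets v (kcons y k), rets (tcons y v) k);
    (rets v (kcomp f k), run f v k);
    (ret y stop, accept) ].

Definition search : trs :=
  let c := Var 0 in let n := Var 1 in let x := Var 2 in
  [ (guess c n x, guess c n (tsucc x));
    (guess c n x, run (Fn 9 [c]) (tcons x (tcons n tnil)) stop);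
    (guess c n x, accept) ].

Definition interpreter : trs := machine ++ search.

Lemma wf_interpreter : wf_trs interpreter.
Proof.
  intros p Hp. cbn in Hp.
  repeat (destruct Hp as [<-|Hp]; [split; [discriminate|lazy; tauto]|]). destruct Hp.
Qed.

Lemma rule_step i ts l r :
  nth_error interpreter i = Some (l, r) ->
  step interpreter (subst (subst_of ts) l) (subst (subst_of ts) r).
Proof. intros H. constructor. eapply nth_error_In, H. Qed.

(** Performs a root step with rule number [i] of [interpreter]; [ts] lists the values of its
    variables in order, with fillers for those absent from the rule. *)
Ltac fire i ts :=
  eapply rt_trans; [apply rt_step; exact (rule_step i ts _ _ eq_refl)|].

Lemma code_rect' (P : code -> Prop) :
  P CZero -> P CSucc -> (forall i, P (CProj i)) ->
  (forall f gs, P f -> Forall P gs -> P (CComp f gs)) ->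
  (forall f g, P f -> P g -> P (CPrec f g)) -> (forall f, P f -> P (CMu f)) ->
  forall c, P c.
Proof.
  intros HZ HS HP HC HR HM. fix IH 1. intros [| |i|f gs|f g|f];
    [exact HZ|exact HS|apply HP|apply HC|apply HR|apply HM]; try apply IH.
  induction gs; constructor; auto.
Qed.

Notation "s ~> t" := (steps interpreter s t) (at level 70).

(** [Hf] is the induction hypothesis of [run_complete]; each successor value sends the machine on to
    the next candidate. *)
Lemma run_mu f v n k :
  (forall w z k, eval f w z -> run (tcode f) (tlist w) k ~> ret (tnum z) k) ->
  (forall m, m < n -> exists z, eval f (m :: v) (S z)) ->
  run (tcode (CMu f)) (tlist v) k ~>
  run (tcode f) (tlist (n :: v)) (kmu (tcode f) (tnum n) (tlist v) k).
Proof.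
  intros Hf. induction n as [|n IH]; intros Hn.
  - fire 9 [k; tlist v; tcode f]. apply rt_refl.
  - destruct (Hn n) as [z Hz]; [lia|].
    eapply rt_trans; [apply IH; intros; apply Hn; lia|].
    eapply rt_trans; [apply Hf, Hz|].
    fire 12 [k; tlist v; tcode f; tnil; tnum n; tnum z]. apply rt_refl.
Qed.

(** For [CMu] the evaluations at smaller candidates sit under an existential quantifier; induction
    on the code, general in arguments and continuation, reaches them all. *)
Lemma run_complete c :
  forall v z k, eval c v z -> run (tcode c) (tlist v) k ~> ret (tnum z) k.
Proof.
  induction c as [| |i|f gs IHf IHgs|f g IHf IHg|f IHf] using code_rect';
    intros v z k H; inversion H; subst; clear H.
  - fire 0 [k; tlist v]. apply rt_refl.
  - destruct v as [|x v].
    + fire 1 [k]. apply rt_refl.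
    + fire 2 [k; tlist v; tnil; tnil; tnum x]. apply rt_refl.
  - revert v. induction i as [|i IH]; intros [|x v].
    + fire 3 [k; tnil; tnil; tnil; tnil; tzero]. apply rt_refl.
    + fire 4 [k; tlist v; tnil; tnil; tnum x]. apply rt_refl.
    + fire 3 [k; tnil; tnil; tnil; tnil; tnum (S i)]. apply rt_refl.
    + fire 5 [k; tlist v; tnil; tnil; tnum x; tnum i]. apply IH.
  - fire 6 [k; tlist v; tcode f; tcodes gs].
    enough (Hgs : forall k, runs (tcodes gs) (tlist v) k ~> rets (tlist ys) k).
    { eapply rt_trans; [apply Hgs|]. fire 17 [k; tlist ys; tcode f]. now apply IHf. }
    match goal with H : evals _ _ _ |- _ => revert H end. clear - IHgs. revert ys.
    induction IHgs as [|g gs Hg _ IH]; intros ys H; inversion H; subst; intros k.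
    + fire 13 [k; tlist v]. apply rt_refl.
    + fire 14 [k; tlist v; tcode g; tcodes gs]. eapply rt_trans; [apply Hg; eassumption|].
      fire 15 [k; tlist v; tnil; tcodes gs; tnil; tnum y].
      eapply rt_trans; [apply IH; eassumption|].
      fire 16 [k; tlist ys0; tnil; tnil; tnil; tnum y]. apply rt_refl.
  - fire 7 [k; tlist v0; tcode f; tcode g]. now apply IHf.
  - match goal with H : eval (CPrec _ _) (n :: _) _ |- _ => rename H into Hp end.
    match goal with H : eval g _ _ |- _ => rename H into Hg end.
    rename v0 into v. revert k y z Hp Hg.
    (* The recursive call runs the same code, so an inner induction on the recursion argument is
       needed. *)
    assert (Hrec : forall n y k, eval (CPrec f g) (n :: v) y ->
      run (tcode (CPrec f g)) (tlist (n :: v)) k ~> ret (tnum y) k).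
    { clear n. induction n as [|n IH]; intros y k Hp; inversion Hp; subst.
      - fire 7 [k; tlist v; tcode f; tcode g]. now apply IHf.
      - fire 8 [k; tlist v; tcode f; tcode g; tnum n].
        eapply rt_trans; [apply IH; eassumption|].
        fire 10 [k; tlist v; tnil; tcode g; tnum n; tnum y0].
        apply (IHg (n :: y0 :: v)). assumption. }
    intros k y z Hp Hg. apply Hrec. eapply ev_precS; eauto.
  - eapply rt_trans; [apply (run_mu _ _ z); auto|].
    eapply rt_trans; [apply IHf; eassumption|].
    fire 11 [k; tlist v; tcode f; tnil; tnum z]. apply rt_refl.
Qed.

(** * Determinism of the machine *)

(* Symbols below 20 build data and stack frames; no left-hand side has one of them at its root. *)
Fixpoint passive (t : term) : bool :=
  match t with
  | Var _ => false
  | Fn f l => (f <? 20) && forallb passive l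
  end.

Lemma passive_normal t : passive t = true -> forall u, ~ step interpreter t u.
Proof.
  induction t as [x|f l IH] using term_rect'; intros Ht u H; [discriminate|].
  cbn [passive] in Ht. apply andb_prop in Ht as [Hf Hl]. apply Nat.ltb_lt in Hf.
  inversion H as [l' r sigma Hin E|f' a b s t' Hs E]; subst.
  - cbn in Hin.
    repeat (destruct Hin as [Hin|Hin]; [injection Hin as <- <-; injection E as E; lia|]).
    destruct Hin.
  - rewrite forallb_forall in Hl. rewrite Forall_forall in IH.
    assert (Hin : In s (a ++ s :: b)) by (apply in_elt). now apply (IH s Hin (Hl s Hin) t').
Qed.

(** Passive arguments are normal, so a redex can only be the whole term. *)
Definition config (f : nat) (t : term) : Prop :=
  exists l, t = Fn f l /\ forallb passive l = true.
Definition running (t : term) : Prop :=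
  config 20 t \/ config 21 t \/ config 22 t \/ config 23 t.

Lemma config_step f t u :
  config f t -> step interpreter t u ->
  exists l r sigma, In (l, r) interpreter /\ t = subst sigma l /\ u = subst sigma r.
Proof.
  intros (l & -> & Hl) H. inversion H as [l' r sigma Hin E|f' a b s t' Hs E]; subst.
  - exists l', r, sigma. auto.
  - rewrite forallb_forall in Hl. exfalso.
    apply (passive_normal s) with (u := t'); auto. apply Hl, in_elt.
Qed.

Lemma running_step t u :
  running t -> step interpreter t u ->
  exists l r sigma, In (l, r) machine /\ t = subst sigma l /\ u = subst sigma r.
Proof.
  intros H Hs.
  assert (exists l r sigma, In (l, r) interpreter /\ t = subst sigma l /\ u = subst sigma r)
    as (l & r & sigma & Hin & -> & ->)
    by (destruct H as [H|[H|[H|H]]]; eauto using config_step).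
  exists l, r, sigma. split; auto. apply in_app_or in Hin as [Hin|Hin]; auto. exfalso.
  cbn in Hin. repeat destruct Hin as [Hin|Hin]; try injection Hin as <- <-; auto;
    destruct H as [(? & E & _)|[(? & E & _)|[(? & E & _)|(? & E & _)]]]; discriminate.
Qed.

(** Left-hand sides of distinct rules do not unify, and for one rule the matched values fix the
    right-hand side. *)
Lemma machine_deterministic l r sigma l' r' sigma' :
  In (l, r) machine -> In (l', r') machine -> subst sigma l = subst sigma' l' ->
  subst sigma r = subst sigma' r'.
Proof.
  intros H H'. cbn in H, H'.
  repeat (destruct H as [H|H];
    [injection H as <- <-; cbn;
     repeat (destruct H' as [H'|H']; [injection H' as <- <-; cbn; intros E;
       first [ discriminate E
             | injection E; intros; unfold tzero, tsucc, tnil, tcons in *; congruence ]|]);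
     destruct H'|]).
  destruct H.
Qed.

Lemma running_deterministic t u u' :
  running t -> step interpreter t u -> step interpreter t u' -> u = u'.
Proof.
  intros Ht H H'. apply running_step in H as (l & r & sigma & Hin & -> & ->); auto.
  apply running_step in H' as (l' & r' & sigma' & Hin' & E & ->); auto.
  eapply machine_deterministic; eauto.
Qed.

Lemma running_preserved t u : running t -> step interpreter t u -> running u \/ u = accept.
Proof.
  intros Ht H. pose proof H as (l & r & sigma & Hin & -> & ->)%running_step; auto.
  assert (Hp : forall f a, subst sigma l = Fn f a -> forallb passive a = true).
  { intros f a E. destruct Ht as [Ht|[Ht|[Ht|Ht]]]; destruct Ht as (b & E' & Hb); congruence. }
  clear Ht H. cbn in Hin.
  repeat (destruct Hin as [Hin|Hin];
    [injection Hin as <- <-; cbn in Hp; specialize (Hp _ _ eq_refl); cbn in Hp;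
     rewrite ?Bool.andb_true_iff in Hp;
     try (right; reflexivity); left;
     (* Backtracks over the four possible root symbols of the contractum. *)
     (left + (right; (left + (right; (left + right)))));
     eexists; (split; [reflexivity|]); cbn; rewrite ?Bool.andb_true_iff; tauto|]).
  destruct Hin.
Qed.

Lemma accept_normal u : ~ step interpreter accept u.
Proof. now apply passive_normal. Qed.

Fixpoint nsteps (n : nat) (t u : term) : Prop :=
  match n with 0 => t = u | S m => exists s, step interpreter t s /\ nsteps m s u end.

Lemma steps_nsteps t u : t ~> u -> exists n, nsteps n t u.
Proof.
  intros H. apply clos_rt_rt1n in H. induction H as [|t s u H _ [n IH]].
  - now exists 0.
  - exists (S n), s. auto.
Qed.

Lemma nsteps_steps n t u : nsteps n t u -> t ~> u.
Proof.
  revert t. induction n as [|n IH]; intros t; [intros ->; apply rt_refl|].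
  intros (s & Hs & H). exact (rt_trans _ _ _ _ _ (rt_step _ _ _ _ Hs) (IH _ H)).
Qed.

(** By determinism every reduct lies on the unique path to [accept]. The bound on the remaining
    length is the induction measure in [run_mu_sound]. *)
Lemma running_confluent t u n :
  running t -> t ~> u -> nsteps n t accept ->
  (running u \/ u = accept) /\ exists m, m <= n /\ nsteps m u accept.
Proof.
  intros Ht H. apply clos_rt_rt1n in H. revert n Ht.
  induction H as [t|t s u H Hs IH]; intros n Ht Hn; [eauto|].
  destruct n as [|n]; [cbn in Hn; subst t; now apply accept_normal in H|].
  destruct Hn as (s' & H' & Hn). rewrite (running_deterministic _ _ _ Ht H' H) in Hn.
  destruct (running_preserved _ _ Ht H) as [Hr| ->].
  - destruct (IH n Hr Hn) as (H1 & m & H2 & H3). eauto.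
  - inversion Hs as [|? ? H3]; subst; [|now apply accept_normal in H3].
    split; auto. exists n. auto.
Qed.

(** * Correctness of unbounded search *)

Lemma passive_tnum n : passive (tnum n) = true.
Proof. induction n as [|n IH]; [reflexivity|]. cbn. now rewrite IH. Qed.

Lemma passive_tlist v : passive (tlist v) = true.
Proof. induction v as [|n v IH]; [reflexivity|]. cbn. now rewrite passive_tnum, IH. Qed.

Lemma passive_tcode c : passive (tcode c) = true.
Proof.
  induction c as [| |i|f gs IHf IHgs|f g IHf IHg|f IHf] using code_rect';
    cbn; rewrite ?IHf, ?IHg; auto.
  - now rewrite (passive_tnum i).
  - induction IHgs as [|g gs Hg _ IH]; [reflexivity|]. cbn. rewrite Hg.
    cbn in IH |- *. now rewrite IH.
Qed.

Lemma running_run c k v : passive k = true -> running (run (tcode c) (tlist v) k).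
Proof.
  intros Hk. left. eexists. split; [reflexivity|].
  cbn. now rewrite passive_tcode, passive_tlist, Hk.
Qed.

(** Induction on the steps left before [accept]: a successor value at [y] leads the run to the
    candidate [S y] with strictly fewer steps left. *)
Lemma run_mu_sound c v Q n y :
  (forall y, exists z, eval c (y :: v) z /\ (Q y <-> z = 0)) ->
  nsteps n (run (tcode c) (tlist (y :: v)) (kmu (tcode c) (tnum y) (tlist v) stop)) accept ->
  exists y, Q y.
Proof.
  intros Hc. revert y. induction n as [n IH] using lt_wf_ind. intros y Hn.
  destruct (Hc y) as ([|z] & Hz & HQ); [exists y; now apply HQ|].
  set (k := kmu (tcode c) (tnum y) (tlist v) stop) in *.
  assert (Hr : running (run (tcode c) (tlist (y :: v)) k)).
  { apply running_run. cbn. now rewrite passive_tcode, passive_tnum, passive_tlist. }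
  pose proof (run_complete _ _ _ k Hz) as Hret.
  destruct (running_confluent _ _ _ Hr Hret Hn) as ([Hr'|E] & m & Hm & Hn'); [|discriminate].
  destruct m as [|m]; [discriminate|]. destruct Hn' as (s & Hs & Hn').
  rewrite (running_deterministic _ _ _ Hr' Hs
    (rule_step 12 [stop; tlist v; tcode c; tnil; tnum y; tnum z] _ _ eq_refl)) in Hn'.
  apply (IH m) with (y := S y); [lia|exact Hn'].
Qed.

(** Totality of [E] supplies at each candidate a value that is 0 or a successor, so the search below
    [n] is constructive. *)
Lemma least_zero (E : nat -> nat -> Prop) :
  (forall y, exists z, E y z) -> forall n,
  (forall m, m < n -> exists z, E m (S z)) \/
  (exists y, E y 0 /\ forall m, m < y -> exists z, E m (S z)).
Proof.
  intros HE. induction n as [|n [IH|IH]]; [left; lia| |auto].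
  destruct (HE n) as [[|z] Hz]; [eauto|].
  left. intros m Hm. destruct (Nat.eq_dec m n) as [->|Hmn]; [eauto|]. apply IH; lia.
Qed.

Lemma mu_accept c v Q :
  (forall y, exists z, eval c (y :: v) z /\ (Q y <-> z = 0)) ->
  run (tcode (CMu c)) (tlist v) stop ~> accept <-> exists y, Q y.
Proof.
  intros Hc.
  assert (Hr : running (run (tcode (CMu c)) (tlist v) stop)) by now apply running_run.
  split.
  - intros H. apply steps_nsteps in H as [n Hn].
    destruct n as [|n]; [discriminate|]. destruct Hn as (s & Hs & Hn).
    rewrite (running_deterministic _ _ _ Hr Hs
      (rule_step 9 [stop; tlist v; tcode c] _ _ eq_refl)) in Hn.
    exact (run_mu_sound c v Q n 0 Hc Hn).
  - intros [y Hy].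
    assert (exists y, eval c (y :: v) 0 /\ forall m, m < y -> exists z, eval c (m :: v) (S z))
      as (y' & H0 & Hlt).
    { destruct (least_zero (fun y z => eval c (y :: v) z)) with (n := S y) as [H|H]; auto.
      - intros y'. destruct (Hc y') as (z & Hz & _). eauto.
      - destruct (Hc y) as (z & Hz & HQ). apply HQ in Hy as ->.
        (* The value 0 at [y] with successor values below makes [y] itself the witness, without
           comparing two evaluations at [y]. *)
        destruct (least_zero (fun y z => eval c (y :: v) z)) with (n := y) as [H'|H']; eauto.
        intros y'. destruct (Hc y') as (z & Hz' & _). eauto. }
    eapply rt_trans; [apply run_complete, ev_mu; eassumption|].
    fire 18 [stop; tnil; tnil; tnil; tnil; tnum y']. apply rt_refl.
Qed.

(** * Confluence of the guessing term and the reduction *)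

Lemma guess_step c n x u :
  step interpreter (guess (tcode c) (tnum n) (tnum x)) u ->
  u = guess (tcode c) (tnum n) (tnum (S x)) \/
  u = run (tcode (CMu c)) (tlist [x; n]) stop \/ u = accept.
Proof.
  intros H. apply (config_step 24) in H as (l & r & sigma & Hin & E & ->).
  - cbn in Hin.
    repeat (destruct Hin as [Hin|Hin]; [injection Hin as <- <-; try discriminate E|]);
      [..|destruct Hin]; injection E as E1 E2 E3; cbn; rewrite <- ?E1, <- ?E2, <- ?E3; auto.
  - eexists. split; [reflexivity|]. cbn. now rewrite passive_tcode, !passive_tnum.
Qed.

Lemma guess_reaches c n x :
  guess (tcode c) (tnum n) (tnum 0) ~> guess (tcode c) (tnum n) (tnum x).
Proof.
  induction x as [|x IH]; [apply rt_refl|]. eapply rt_trans; [apply IH|].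
  fire 19 [tcode c; tnum n; tnum x]. apply rt_refl.
Qed.

Lemma confluent_on_guess c n Q :
  (forall x y, exists z, eval c [y; x; n] z /\ (Q x y <-> z = 0)) ->
  confluent_on interpreter (guess (tcode c) (tnum n) (tnum 0)) <-> forall x, exists y, Q x y.
Proof.
  intros Hc.
  assert (Hmu : forall x, run (tcode (CMu c)) (tlist [x; n]) stop ~> accept <-> exists y, Q x y)
    by (intros x; apply mu_accept, Hc).
  assert (Hacc : forall x, guess (tcode c) (tnum n) (tnum x) ~> accept).
  { intros x. fire 21 [tcode c; tnum n; tnum x]. apply rt_refl. }
  assert (Hnormal : forall u, accept ~> u -> u = accept).
  { intros u H. apply clos_rt_rt1n in H.
    inversion H as [|? ? H3]; subst; [auto|now apply accept_normal in H3]. }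
  split.
  - intros H x. apply Hmu.
    (* [accept] is normal, so its common reduct with the search state can only be [accept]. *)
    destruct (H accept (run (tcode (CMu c)) (tlist [x; n]) stop)) as (d & H1 & H2).
    + apply Hacc.
    + eapply rt_trans; [apply (guess_reaches c n x)|].
      fire 20 [tcode c; tnum n; tnum x]. apply rt_refl.
    + now apply Hnormal in H1 as ->.
  - intros H.
    (* Induction along the reduction: raising [x] keeps the form of the term, and entering the
       search leaves a deterministic run whose reducts all reach [accept]. *)
    assert (Hall : forall x u, guess (tcode c) (tnum n) (tnum x) ~> u -> u ~> accept).
    { intros x u Hu. apply clos_rt_rt1n in Hu.
      remember (guess (tcode c) (tnum n) (tnum x)) as t eqn:Et. revert x Et.
      induction Hu as [t|t s u Hs Hu IH]; intros x ->; [apply Hacc|].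
      destruct (guess_step _ _ _ _ Hs) as [->|[->| ->]]; [eauto| |];
        apply clos_rt1n_rt in Hu.
      - assert (Hr : running (run (tcode (CMu c)) (tlist [x; n]) stop)) by now apply running_run.
        pose proof (proj2 (Hmu x) (H x)) as Hx. apply steps_nsteps in Hx as [k Hk].
        destruct (running_confluent _ _ _ Hr Hu Hk) as (_ & m & _ & Hm).
        exact (nsteps_steps _ _ _ Hm).
      - apply Hnormal in Hu as ->. apply rt_refl. }
    intros t1 t2 H1 H2. exists accept. eauto.
Qed.

Lemma ground_passive t : passive t = true -> ground t.
Proof.
  induction t as [x|f l IH] using term_rect'; intros H; [discriminate|].
  unfold ground. rewrite vars_Fn. cbn [passive] in H. apply andb_prop in H as [_ H].
  induction IH as [|a l Ha _ IHl]; [reflexivity|]. cbn in *. apply andb_prop in H as [H1 H2].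
  unfold ground in Ha. now rewrite Ha, IHl.
Qed.

(** Only the numeral varies with the input, and its code is computed by primitive recursion. *)
Lemma cf_guess_code r c :
  cf (fun v => cpair r (enc_term (guess c (tnum (nth 0 v 0)) (tnum 0)))).
Proof.
  assert (cf (fun v => enc_term (tnum (nth 0 v 0)))).
  { refine (cf_ext _ _ _ (cf_rec (fun _ => enc_term tzero)
      (fun _ y _ => S (2 * cpair 1 (S (cpair y 0)))) _ _ _ (fun _ => 0)
      (cf_proj 0) (cf_const 0))); cf_solve.
    intros v. cbn beta. induction (nth 0 v 0) as [|n IH]; [reflexivity|].
    cbn [nat_rect tnum]. rewrite IH. symmetry. apply enc_Fn. }
  apply (cf_ext (fun v => cpair r (S (2 * cpair 24 (S (cpair (enc_term c)
    (S (cpair (enc_term (tnum (nth 0 v 0))) (S (cpair (enc_term (tnum 0)) 0)))))))))).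
  { intros v. unfold guess. rewrite enc_Fn. reflexivity. }
  cf_solve.
Qed.

(** The terms produced are ground, so one reduction serves both sets. *)
Lemma Pi02_reduction B :
  Pi02 B -> exists f, computable f /\ forall n, exists R t,
    f n = enc_pair R t /\ wf_trs R /\ ground t /\ (B n <-> confluent_on R t).
Proof.
  intros (P & (c & Hc) & HB).
  (* The decider expects [[n; x; y]], but [CMu] puts its candidate in front and calls with
     [[y; x; n]]; the projections reverse the list. *)
  set (c' := CComp c [CProj 2; CProj 1; CProj 0]).
  exists (fun n => enc_pair interpreter (guess (tcode c') (tnum n) (tnum 0))). split.
  - destruct (cf_guess_code (enc_trs interpreter) (tcode c')) as [d Hd].
    exists d. intros n. exact (Hd [n]).
  - intros n. exists interpreter, (guess (tcode c') (tnum n) (tnum 0)).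
    split; [reflexivity|]. split; [apply wf_interpreter|]. split.
    + unfold ground, guess. rewrite vars_Fn. cbn [flat_map].
      now rewrite !(ground_passive _ (passive_tnum _)), (ground_passive _ (passive_tcode _)).
    + rewrite HB. symmetry. apply confluent_on_guess. intros x y.
      destruct (Hc n x y) as (z & Hz & HP). exists z. split; auto.
      apply ev_comp with (ys := [n; x; y]); auto.
      repeat apply evs_cons; try apply evs_nil.
      * apply (ev_proj 2 [y; x; n]).
      * apply (ev_proj 1 [y; x; n]).
      * apply (ev_proj 0 [y; x; n]).
Qed.

Theorem theorem4 : Pi02_complete CONF_term /\ Pi02_complete CONF_ground_term.
Proof.
  repeat split; try apply Pi02_CONF_term; try apply Pi02_CONF_ground_term;
    intros B HB; destruct (Pi02_reduction B HB) as (f & Hf & H); exists f; split; auto;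
    intros n; destruct (H n) as (R & t & -> & Hwf & Ht & ->); split.
  - intros HC. exists R, t. auto.
  - intros (R' & t' & E & _ & HC). now apply enc_pair_inj in E as [<- <-].
  - intros HC. exists R, t. auto.
  - intros (R' & t' & E & _ & _ & HC). now apply enc_pair_inj in E as [<- <-].
Qed.
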